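(* Let $a\neq 0$ and let $F$ be a finite set of nonnegative integers. Then, as polynomials in $x$, $$\mathtt{C}_{F,x}^{a}=(-1)^{w_F}\,\mathtt{C}_{I(F),-x}^{-a}.$$
   Context: For $a\neq 0$ (a complex number) the Charlier polynomials are $$c_n^a(x)=\frac{1}{n!}\sum_{j=0}^n(-a)^{n-j}\binom{n}{j}\binom{x}{j}j!,\qquad n\ge 0,$$ where $\binom{x}{j}=x(x-1)\cdots(x-j+1)/j!$. For a finite set $F=\{f_1<f_2<\cdots<f_k\}$ of nonnegative integers define: - the Casorati-Charlier determinant $\mathtt{C}_{F,x}^{a}=\det\big(c_{f_i}^{a}(x+j-1)\big)_{i,j=1}^k$, a polynomial in $x$; $\mathtt{C}_{I(F),-x}^{-a}$ denotes the polynomial $\mathtt{C}_{I(F),y}^{-a}$ evaluated at $y=-x$; - $w_F=\sum_{f\in F}f-\binom{k}{2}$; - $I(F)=\{0,1,2,\dots,\max F\}\setminus\{\max F-f: f\in F\}$. Conventions: the determinant of an empty matrix is $1$; $\max\emptyset=-1$, so that $I(\emptyset)=\emptyset$. *)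

(* Defs.v *)
From mathcomp Require Import all_boot all_order all_algebra finmap.
From mathcomp Require Import complex reals.
Set Implicit Arguments.
Unset Strict Implicit.
Unset Printing Implicit Defensive.
Import Order.TTheory GRing.Theory Num.Theory.
Local Open Scope fset_scope.
Local Open Scope ring_scope.

(* The generalized binomial coefficient x(x-1)...(x-j+1)/j! as a polynomial in x. *)
Definition binomp (K : fieldType) (j : nat) : {poly K} :=
  (j`!%:R)^-1 *: \prod_(i < j) ('X - (i%:R)%:P).

Definition charlier (K : fieldType) (a : K) (n : nat) : {poly K} :=
  (n`!%:R)^-1 *:
    \sum_(j < n.+1) ((- a) ^+ (n - j) * 'C(n, j)%:R * j`!%:R) *: binomp K j.

(* The increasing enumeration f_1 < ... < f_k of F, as a 0-indexed list. *)
Definition fenum (F : {fset nat}) : seq nat := sort leq (enum_fset F).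

(* Columns are 0-indexed, so that the shift x + j - 1 becomes x + j. *)
Definition casorati (K : fieldType) (a : K) (F : {fset nat}) : {poly K} :=
  \det (\matrix_(i < #|` F|, j < #|` F|)
          (charlier a (nth 0%N (fenum F) i) \Po ('X + (j%:R)%:P))).

Definition wF (F : {fset nat}) : int :=
  (\sum_(f <- F) f)%N%:Z - ('C(#|` F|, 2))%:Z.

(* max F + 1; it is 0 when F is empty, in accordance with max(empty) = -1. *)
Definition maxS (F : {fset nat}) : nat := (\max_(f <- F) f.+1)%N.

(* {0, ..., max F} \ {max F - f : f in F}; the subtraction is never truncated. *)
Definition invol (F : {fset nat}) : {fset nat} :=
  [fset i in iota 0 (maxS F)] `\` [fset ((maxS F).-1 - f)%N | f in F].

(* Main.v *)
Require Import Defs.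
From mathcomp Require Import all_boot all_order all_algebra finmap.
From mathcomp Require Import fingroup perm.
From mathcomp Require Import complex reals.
From mathcomp Require Import zify ring.
Set Implicit Arguments.
Unset Strict Implicit.
Unset Printing Implicit Defensive.
Import Order.TTheory GRing.Theory Num.Theory.
Local Open Scope ring_scope.

(** The Charlier polynomials have the generating series
  H(z) = sum_n c_n^a(x) z^n = exp(-a z) (1 + z)^x.
Replacing x by x + 1 multiplies H by 1 + z, that is
c_n(x + 1) = c_n(x) + c_(n-1)(x).  Hence the shifts by 0, 1, ..., k - 1 in the
columns of the Casorati determinant can be traded, through a unitriangular
matrix of binomial coefficients, for shifts of the index: the determinant is
det (c_(f_i - j)(x)), the minor with rows F and columns 0, ..., k - 1 of the
lower unitriangular Toeplitz matrix T of H ([casorati_toeplitz]).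

Replacing (a, x) by (-a, -x) turns H into 1 / H, so the Toeplitz matrix of the
polynomials c_n^(-a)(-x) is the inverse of T ([charlier_convolution],
[toeplitz_mul]).  With N = max F + 1, Jacobi's complementary minor identity
([jacobi_complementary_minor]) equates, up to sign, the minor of T above with
the minor of the inverse of T whose rows are k, ..., N - 1 and whose columns are
the complement of F in 0, ..., N - 1.  A Toeplitz matrix is symmetric about its
antidiagonal; reflecting all the indices by i -> N - 1 - i therefore turns this
last minor into the one with rows I(F) and columns 0, 1, ..., which is the
Casorati determinant of I(F) for the parameters -a and -x
([toeplitz_minor_duality]).  The sign is that of the permutation listing F and
then its complement, each in increasing order ([det_unitriangular_shuffle]). *)

(** * Jacobi's complementary minor identity *)

(** Replacing the first k columns of B by those of the identity gives a block
upper triangular matrix of determinant det (drsubmx B), and A maps it to the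
block lower triangular matrix with diagonal blocks ulsubmx A and 1. *)
Lemma jacobi_complementary_minor (R : comNzRingType) (k m : nat)
    (A B : 'M[R]_(k + m)) :
  A *m B = 1%:M -> \det A * \det (drsubmx B) = \det (ulsubmx A).
Proof.
move=> AB1.
have [Hur Hdr] : ulsubmx A *m ursubmx B + ursubmx A *m drsubmx B = 0 /\
    dlsubmx A *m ursubmx B + drsubmx A *m drsubmx B = 1%:M.
  move: AB1; rewrite -[A in LHS]submxK -[B in LHS]submxK mulmx_block scalar_mx_block.
  by case/eq_block_mx.
have AC : A *m block_mx 1%:M (ursubmx B) 0 (drsubmx B)
    = block_mx (ulsubmx A) 0 (dlsubmx A) 1%:M.
  rewrite -[A in LHS]submxK mulmx_block Hur Hdr.
  by rewrite !mulmx1 !mulmx0 !addr0.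
have := congr1 determinant AC.
by rewrite det_mulmx det_ublock det_lblock !det1 mul1r mulr1.
Qed.

(** * The sign of a shuffle *)

(** The last column of T restricted to the indices 0, ..., N has N-th entry 1 and
vanishes elsewhere, so the determinant is expanded along it; the row indexed by N
sits in position size t. *)
Lemma det_expand_max_entry (R : comNzRingType) (T : nat -> nat -> R) (N : nat)
    (t r : seq nat) :
  (forall i, T i i = 1) -> (forall i j, (i < j)%N -> T i j = 0) ->
  perm_eq (t ++ r) (iota 0 N) ->
  \det (\matrix_(i < N.+1, j < N.+1) T (nth 0%N (t ++ N :: r) i) j)
  = (-1) ^+ (size t + N) * \det (\matrix_(i < N, j < N) T (nth 0%N (t ++ r) i) j).
Proof.
move=> T1 T0 tr_perm.
have sz : size (t ++ r) = N by rewrite (perm_size tr_perm) size_iota.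
have lt_t : (size t < N.+1)%N by move: sz; rewrite size_cat; lia.
pose i0 : 'I_N.+1 := Ordinal lt_t.
have nth_lift (i : 'I_N) :
    nth 0%N (t ++ N :: r) (lift i0 i) = nth 0%N (t ++ r) i.
  rewrite /= /bump !nth_cat; case: (leqP (size t) i) => hi /=.
    by rewrite add1n ltnNge leqW //= subSn //= ltnNge hi.
  by rewrite add0n hi.
rewrite (expand_det_col _ ord_max) (bigD1 i0) //= big1 ?addr0; last first.
  move=> i /eqP; case: (unliftP i0 i) => [i' ->|->] // _.
  rewrite mxE nth_lift T0 ?mul0r //=.
  suff : nth 0%N (t ++ r) i' \in iota 0 N by rewrite mem_iota.
  by rewrite -(perm_mem tr_perm) mem_nth // sz.
rewrite mxE /= nth_cat ltnn subnn T1 mul1r /cofactor /=.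
congr (_ * \det _); apply/matrixP => i j.
by rewrite !mxE nth_lift lift_max.
Qed.

Lemma sorted_last_max (N : nat) (s : seq nat) :
  sorted ltn s -> all (fun i => i <= N)%N s -> N \in s ->
  exists t, s = rcons t N.
Proof.
case/lastP: s => // t x; rewrite sorted_pairwise; last exact: ltn_trans.
rewrite pairwise_rcons all_rcons => /andP[/allP tx _] /andP[xN _].
rewrite mem_rcons inE => /orP[/eqP -> | /tx /= Nx]; first by exists t.
by move: xN; rewrite leqNgt Nx.
Qed.

Lemma sorted_rcons_prefix (t : seq nat) x : sorted ltn (rcons t x) -> sorted ltn t.
Proof. by rewrite -cats1 => /cat_sorted2[]. Qed.

(** The determinant is the signature of the permutation listing s and then s'.
The largest index N - 1 comes last either in s' or in s.  In the first case
removing it costs no sign; in the second it has to cross the elements of s',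
which are N - size s in number.  Altogether the exponent is the sum over s of
the differences between an element and its position, which has the parity of
sumn s + 'C(size s, 2). *)
Lemma det_unitriangular_shuffle (R : comNzRingType) (T : nat -> nat -> R) (N : nat)
    (s s' : seq nat) :
  (forall i, T i i = 1) -> (forall i j, (i < j)%N -> T i j = 0) ->
  sorted ltn s -> sorted ltn s' -> perm_eq (s ++ s') (iota 0 N) ->
  \det (\matrix_(i < N, j < N) T (nth 0%N (s ++ s') i) j)
  = (-1) ^+ (sumn s + 'C(size s, 2)).
Proof.
move=> T1 T0; elim: N s s' => [|N IHN] s s' ss ss' Hp.
  have /eqP := perm_size Hp; rewrite size_cat size_iota addn_eq0.
  by case/andP => /nilP -> /nilP ->; rewrite det_mx00.
have bnd : all (fun i => i <= N)%N (s ++ s').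
  by apply/allP => i; rewrite (perm_mem Hp) mem_iota.
have [bs bs'] : all (fun i => i <= N)%N s /\ all (fun i => i <= N)%N s'.
  by apply/andP; rewrite -all_cat.
have perm_del t r : perm_eq (t ++ N :: r) (iota 0 N.+1) -> perm_eq (t ++ r) (iota 0 N).
  rewrite -addn1 iotaD /= add0n => H.
  rewrite -(perm_cons N) -(cat1s N (t ++ r)) perm_catCA; apply: (perm_trans H).
  by rewrite perm_catC.
have : N \in s ++ s' by rewrite (perm_mem Hp) mem_iota add0n leqnn.
rewrite mem_cat => /orP[Ns | Ns'].
  have [t st] := sorted_last_max ss bs Ns; move: ss Hp.
  rewrite st cat_rcons => /sorted_rcons_prefix st' /perm_del Hp.
  rewrite det_expand_max_entry // IHN // -exprD sumn_rcons size_rcons binS bin1.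
  by congr (_ ^+ _); lia.
have [t st] := sorted_last_max ss' bs' Ns'; move: ss' Hp.
rewrite st -cats1 catA => + /perm_del; rewrite cats1 cats0.
move=> /sorted_rcons_prefix st' Hp.
rewrite det_expand_max_entry ?cats0 // IHN //.
by rewrite (perm_size Hp) size_iota addnn -mul2n exprM sqrrN expr1n expr1n mul1r.
Qed.

(** * Minors of Toeplitz matrices *)

Definition toeplitz (R : nzRingType) (h : nat -> R) (m n : nat) : R :=
  if (n <= m)%N then h (m - n)%N else 0.

Definition toeplitz_minor (R : comNzRingType) (h : nat -> R) (s : seq nat) : R :=
  \det (\matrix_(i < size s, j < size s) toeplitz h (nth 0%N s i) j).

(** The increasing enumeration of I(F) when s enumerates F and N = max F + 1: the
reversal makes up for the decreasing map i -> N - 1 - i. *)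
Definition reflected_complement (N : nat) (s : seq nat) : seq nat :=
  [seq (N.-1 - i)%N | i <- rev [seq i <- iota 0 N | i \notin s]].

(** Lower triangular Toeplitz matrices multiply like power series: two inverse
series give inverse matrices, also after truncation to the indices below N,
since only the indices between n and m contribute to the entry (m, n). *)
Lemma toeplitz_mul (R : nzRingType) (h e : nat -> R) (N m n : nat) :
  (forall d, \sum_(i < d.+1) h (d - i)%N * e i = (d == 0)%N%:R) ->
  (m < N)%N -> (n < N)%N ->
  \sum_(j < N) toeplitz h m j * toeplitz e j n = (m == n)%:R.
Proof.
move=> he mN nN; have [mn|nm] := ltnP m n.
  rewrite (ltn_eqF mn) big1 // => j _; rewrite /toeplitz.
  case: leqP => [jm|]; last by rewrite mul0r.
  by rewrite leqNgt (leq_ltn_trans jm mn) mulr0.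
rewrite -(big_mkord xpredT (fun j => toeplitz h m j * toeplitz e j n)).
rewrite (big_cat_nat (n := n)) //=; last exact: ltnW.
rewrite big_nat big1 ?add0r; last first.
  by move=> j /andP[_ jn]; rewrite /toeplitz [(n <= j)%N]leqNgt jn mulr0.
rewrite (big_cat_nat (n := m.+1)) //=; last exact: leqW.
rewrite [X in _ + X]big_nat [X in _ + X]big1 ?addr0; last first.
  by move=> j /andP[mj _]; rewrite /toeplitz [(j <= m)%N]leqNgt mj mul0r.
rewrite -{1}(add0n n) big_addn subSn // big_mkord.
rewrite -[RHS](_ : ((m - n)%N == 0)%N%:R = _); last by rewrite subn_eq0 eqn_leq nm andbT.
rewrite -he; apply: eq_bigr => i _; rewrite /toeplitz.
have im : (i + n <= m)%N by have := ltn_ord i; lia.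
by rewrite im leq_addl addnK addnC subnDA.
Qed.

(** Jacobi's identity for the Toeplitz matrix of h, its rows being permuted so
that those indexed by s come first, and for the inverse matrix with its columns
permuted accordingly. *)
Lemma toeplitz_jacobi (R : comNzRingType) (h e : nat -> R) (s s' : seq nat) :
  h 0%N = 1 ->
  (forall d, \sum_(i < d.+1) h (d - i)%N * e i = (d == 0)%N%:R) ->
  sorted ltn s -> sorted ltn s' -> perm_eq (s ++ s') (iota 0 (size s + size s')) ->
  toeplitz_minor h s = (-1) ^+ (sumn s + 'C(size s, 2)) *
    \det (\matrix_(i < size s', j < size s') toeplitz e (size s + i) (nth 0%N s' j)).
Proof.
move=> h0 he ss ss' Hp; set N := (size s + size s')%N in Hp *.
pose A : 'M[R]_N := \matrix_(i, j) toeplitz h (nth 0%N (s ++ s') i) j.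
pose B : 'M[R]_N := \matrix_(i, j) toeplitz e i (nth 0%N (s ++ s') j).
have szN : size (s ++ s') = N by rewrite size_cat.
have nthN (i : 'I_N) : (nth 0 (s ++ s') i < N)%N.
  suff : nth 0%N (s ++ s') i \in iota 0 N by rewrite mem_iota.
  by rewrite -(perm_mem Hp) mem_nth // szN.
have AB : A *m B = 1%:M.
  apply/matrixP => i j; rewrite !mxE.
  under eq_bigr do rewrite !mxE.
  rewrite toeplitz_mul // nth_uniq ?szN //.
  by rewrite (perm_uniq Hp) iota_uniq.
rewrite -(det_unitriangular_shuffle (T := toeplitz h) _ _ ss ss' Hp); first last.
- by move=> i j ij; rewrite /toeplitz leqNgt ij.
- by move=> i; rewrite /toeplitz leqnn subnn.
rewrite -[RHS](_ : \det A * \det (drsubmx B) = _); last first.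
  congr (_ * \det _); apply/matrixP => i j; rewrite !mxE /= nth_cat.
  by rewrite ltnNge leq_addr addKn.
rewrite jacobi_complementary_minor //.
congr (\det _); apply/matrixP => i j.
by rewrite !mxE /= nth_cat ltn_ord.
Qed.

(** Reflection about the antidiagonal composes a transposition with the same
permutation of the rows and of the columns, whose signs cancel. *)
Lemma det_rev (R : comNzRingType) (n : nat) (A : 'M[R]_n) :
  \det (\matrix_(i, j) A (rev_ord j) (rev_ord i)) = \det A.
Proof.
pose r : 'S_n := perm (@rev_ord_inj n).
rewrite -[LHS](_ : \det (row_perm r (col_perm r A))^T = _); last first.
  by congr (\det _); apply/matrixP => i j; rewrite !mxE !permE.
rewrite det_tr row_permE col_permE !det_mulmx !det_perm odd_permV.
by rewrite mulrCA -expr2 sqrr_sign mulr1.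
Qed.

(** The entries of [toeplitz e] depend only on the difference of the indices.
The reflection i -> N - 1 - i negates this difference and the exchange of rows
and columns restores it, so together they carry the minor provided by [toeplitz_jacobi] to one whose
columns are again 0, 1, 2, ... *)
Lemma toeplitz_minor_duality (R : comNzRingType) (h e : nat -> R) (N : nat)
    (s : seq nat) :
  h 0%N = 1 ->
  (forall d, \sum_(i < d.+1) h (d - i)%N * e i = (d == 0)%N%:R) ->
  sorted ltn s -> all (fun i => i < N)%N s ->
  toeplitz_minor h s = (-1) ^+ (sumn s + 'C(size s, 2)) *
    toeplitz_minor e (reflected_complement N s).
Proof.
move=> h0 he ss bs; rewrite /reflected_complement.
pose s' : seq nat := [seq i <- iota 0 N | i \notin s]; rewrite -/s'.
have ltn_irr : irreflexive ltn by move=> i; rewrite /= ltnn.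
have Hp : perm_eq (s ++ s') (iota 0 N).
  apply: uniq_perm; rewrite ?iota_uniq //.
    rewrite cat_uniq (sorted_uniq ltn_trans ltn_irr ss) filter_uniq ?iota_uniq //.
    by rewrite andbT; apply/hasPn => i; rewrite mem_filter => /andP[].
  move=> i; rewrite mem_cat mem_filter mem_iota /= add0n.
  by have [/(allP bs) ->|] := boolP (i \in s).
have szN : (size s + size s')%N = N by rewrite -size_cat (perm_size Hp) size_iota.
have ss' : sorted ltn s' by apply: sorted_filter (iota_ltn_sorted _ _); exact: ltn_trans.
rewrite (toeplitz_jacobi h0 he ss ss') ?szN //; congr (_ * _).
(* The size of t occurs in the type of the matrix, hence cannot be rewritten in place. *)
have minorE n t : size t = n ->
    toeplitz_minor e t = \det (\matrix_(i < n, j < n) toeplitz e (nth 0%N t i) j).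
  by move=> <-.
rewrite (minorE (size s')) ?size_map ?size_rev // -[RHS]det_rev.
congr (\det _); apply/matrixP => i j; rewrite !mxE.
rewrite (nth_map 0%N) ?size_rev ?ltn_ord // nth_rev ?ltn_ord //.
have -> : (size s' - (rev_ord j).+1)%N = j by exact: (f_equal (@nat_of_ord _) (rev_ordK j)).
have : nth 0%N s' j \in iota 0 N.
  by have := mem_nth 0%N (ltn_ord j); rewrite mem_filter => /andP[].
rewrite mem_iota /= add0n /toeplitz => jN.
have iN := ltn_ord i.
by case: leqP => H1; case: leqP => H2 //=; try (congr (e _)); lia.
Qed.

(** * Charlier polynomials *)

Section BinomialShift.
Variable K : numFieldType.
Implicit Types (a : K) (p : {poly K}).

Lemma fact_neq0 n : n`!%:R != 0 :> K.
Proof. by rewrite pnatr_eq0 -lt0n fact_gt0. Qed.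

Lemma binomp0 : binomp K 0 = 1.
Proof. by rewrite /binomp big_ord0 fact0 invr1 scale1r. Qed.

(** Pascal's rule, as an identity of polynomials: both sides share the factor
x (x - 1) ... (x - j + 1). *)
Lemma binompS_shift j :
  binomp K j.+1 \Po ('X + 1%:P) = binomp K j.+1 + binomp K j.
Proof.
rewrite /binomp comp_polyZ [in LHS]big_ord_recl [in X in _ = X + _]big_ord_recr /=.
rewrite rmorphM rmorph_prod /=.
have -> : \prod_(i < j) (('X - (bump 0 i)%:R%:P) \Po ('X + 1%:P))
    = \prod_(i < j) ('X - i%:R%:P) :> {poly K}.
  apply: eq_bigr => i _; rewrite comp_polyB comp_polyX comp_polyC.
  by rewrite /bump /= natrD polyCD opprD addrA addrK.
set P := \prod_(i < j) _.
rewrite comp_polyB comp_polyX comp_polyC subr0.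
have -> : (j`!%:R)^-1 *: P = (j.+1`!%:R)^-1 *: (j.+1%:R%:P * P) :> {poly K}.
  rewrite mul_polyC scalerA factS natrM invfM mulrAC mulVf ?mul1r //.
  by rewrite pnatr_eq0.
rewrite -scalerDr; congr (_ *: _).
rewrite [P * _]mulrC -mulrDl; congr (_ * _).
by rewrite -addn1 natrD polyCD addrA subrK.
Qed.

(** The coefficient of z^n in exp(-a z) times (1 + z)^x. *)
Lemma charlierE a n :
  charlier a n = \sum_(j < n.+1) ((- a) ^+ (n - j) / (n - j)`!%:R) *: binomp K j.
Proof.
rewrite /charlier scaler_sumr; apply: eq_bigr => j _.
have jn : (j <= n)%N by rewrite -ltnS.
rewrite scalerA; congr (_ *: _).
rewrite -(bin_fact jn) !natrM; set c : K := 'C(n, j)%:R.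
have c0 : c != 0 by rewrite pnatr_eq0 -lt0n bin_gt0.
rewrite -!mulrA [j`!%:R * _]mulrC; set f : K := (n - j)`!%:R; set g : K := j`!%:R.
have [f0 g0] : f != 0 /\ g != 0 by rewrite !fact_neq0.
by rewrite !invfM; field; rewrite c0 f0 g0.
Qed.

Lemma charlier0 a : charlier a 0 = 1.
Proof. by rewrite charlierE big_ord1 expr0 fact0 invr1 mulr1 scale1r binomp0. Qed.

(** Multiplication of the generating series by 1 + z. *)
Lemma charlierS_shift a n :
  charlier a n.+1 \Po ('X + 1%:P) = charlier a n.+1 + charlier a n.
Proof.
rewrite !charlierE rmorph_sum /= [LHS]big_ord_recl.
rewrite [X in _ = X + _]big_ord_recl /= -addrA -big_split /=.
rewrite binomp0 comp_polyZ rmorph1; congr (_ + _).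
apply: eq_bigr => j _; rewrite comp_polyZ /bump leq0n add1n binompS_shift.
by rewrite scalerDr subSS.
Qed.

Lemma charlier_at0 a n : (charlier a n).[0] = (- a) ^+ n / n`!%:R.
Proof.
rewrite charlierE big_ord_recl hornerD hornerZ binomp0 hornerC mulr1 subn0.
rewrite horner_sum big1 ?addr0 // => j _.
rewrite hornerZ /binomp hornerZ big_ord_recl hornerM subr0 hornerX.
by rewrite mul0r !mulr0.
Qed.

(** In characteristic zero a periodic polynomial takes the same value at
infinitely many points. *)
Lemma poly_shift_invariant p : p \Po ('X + 1%:P) = p -> p = (p.[0])%:P.
Proof.
move=> pS.
have pn (n : nat) : p.[n%:R] = p.[0].
  elim: n => // n <-; rewrite -[in RHS]pS horner_comp hornerD hornerX hornerC.
  by rewrite natr1.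
apply/eqP; rewrite -subr_eq0; apply/negPn/negP => q0.
set q := p - _ in q0.
pose rs : seq K := [seq i%:R | i <- iota 0 (size q)].
have : (size rs < size q)%N.
  apply: max_poly_roots => //.
    by apply/allP => _ /mapP[i _ ->]; rewrite /root !hornerE pn subrr.
  rewrite map_inj_uniq ?iota_uniq // => i j /eqP.
  by rewrite eqr_nat => /eqP.
by rewrite size_map size_iota ltnn.
Qed.

(** The generating series for (a, x) and (-a, -x) are inverse to each other.  By
[charlierS_shift] the coefficient P of their product is invariant under
x -> x + 1: the factor 1 + z gained by one series is lost by the other.  So P is
constant, and at x = 0 it is the n-th coefficient of exp(-a z) exp(a z), which
the binomial theorem evaluates. *)
Lemma charlier_convolution a n :
  \sum_(i < n.+1) charlier a (n - i) * (charlier (- a) i \Po (- 'X))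
  = (n == 0)%N%:R.
Proof.
case: n => [|n]; first by rewrite big_ord1 !charlier0 comp_polyC mulr1.
set P := LHS.
pose S : {poly K} := 'X + 1%:P.
pose d i := charlier (- a) i \Po (- 'X).
(* d is the family with argument -x, so that S acts on it as a backward shift. *)
have dS i : d i.+1 = (d i.+1 \Po S) + (d i \Po S).
  rewrite /d -!comp_polyA -comp_polyD -charlierS_shift -comp_polyA; congr (_ \Po _).
  by rewrite comp_polyD comp_polyX comp_polyC rmorphN /= comp_polyX opprD addrNK.
have d0 : d 0%N \Po S = d 0%N by rewrite /d charlier0 !comp_polyC.
have PS : P \Po S = P.
  have -> : P \Po S = \sum_(i < n.+2) charlier a (n.+1 - i) * (d i \Po S)
                     + \sum_(i < n.+1) charlier a (n - i) * (d i \Po S).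
    rewrite /P rmorph_sum [LHS]big_ord_recr [in X in _ = X + _]big_ord_recr /=.
    rewrite addrAC -big_split /= subnn rmorphM /= charlier0 comp_polyC.
    congr (_ + _); apply: eq_bigr => i _.
    by rewrite rmorphM /= (subSn (leq_ord i)) charlierS_shift mulrDl.
  rewrite /P [RHS]big_ord_recl [in X in X + _ = _]big_ord_recl -addrA -big_split /=.
  rewrite -/(d _) d0; congr (_ + _); apply: eq_bigr => i _.
  by rewrite /bump leq0n add1n subSS -mulrDr -dS.
rewrite (poly_shift_invariant PS); apply/eqP; rewrite polyC_eq0; apply/eqP.
rewrite [RHS](_ : _ = (- a + a) ^+ n.+1 / n.+1`!%:R); last by rewrite addNr expr0n mul0r.
rewrite exprDn mulr_suml horner_sum; apply: eq_bigr => i _.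
have ni : (i <= n.+1)%N by rewrite -ltnS.
rewrite hornerM horner_comp hornerN hornerX oppr0 !charlier_at0 opprK.
rewrite -(bin_fact ni) !natrM -mulr_natr.
set c : K := 'C(_, _)%:R; set f : K := i`!%:R; set g : K := (_)`!%:R.
have c0 : c != 0 by rewrite pnatr_eq0 -lt0n bin_gt0.
have [f0 g0] : f != 0 /\ g != 0 by rewrite !fact_neq0.
by field; rewrite c0 f0 g0.
Qed.

End BinomialShift.

(** * The Casorati determinant as a Toeplitz minor *)

(** Iterating [charlierS_shift] j times gives
c_n(x + j) = sum_l binomial(j, l) c_(n-l)(x), which factors the Casorati matrix
as the Toeplitz submatrix times the unitriangular matrix U of binomials. *)
Lemma casorati_toeplitz (K : numFieldType) (a : K) (F : {fset nat}) :
  casorati a F = toeplitz_minor (charlier a) (fenum F).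
Proof.
pose c := charlier a.
have toepS n l : toeplitz c n l \Po ('X + 1%:P) = toeplitz c n l + toeplitz c n l.+1.
  rewrite /toeplitz; case: (ltngtP l n) => [ln|nl|->].
  - by rewrite -[(n - l)%N]subnSK // charlierS_shift.
  - by rewrite comp_poly0 addr0.
  - by rewrite subnn /c charlier0 comp_polyC addr0.
have cS n j : c n \Po ('X + (j%:R)%:P) = \sum_(l < j.+1) toeplitz c n l *+ 'C(j, l).
  elim: j => [|j IHj].
    by rewrite addr0 comp_polyXr big_ord1 /toeplitz subn0.
  have -> : 'X + j.+1%:R%:P = ('X + j%:R%:P) \Po ('X + 1%:P) :> {poly K}.
    by rewrite comp_polyD comp_polyX comp_polyC -natr1 polyCD addrAC addrA.
  rewrite comp_polyA IHj rmorph_sum /=.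
  under eq_bigr => l _ do rewrite rmorphMn /= toepS mulrnDl.
  rewrite big_split [RHS]big_ord_recl /=.
  under [in RHS]eq_bigr => l _ do rewrite /bump leq0n add1n binS mulrnDr.
  rewrite big_split /= addrA; congr (_ + _).
  by rewrite big_ord_recl [in RHS]big_ord_recr /= (bin_small (ltnSn j)) mulr0n addr0 !bin0.
have sz : #|` F| = size (fenum F) by rewrite size_sort.
rewrite /casorati /toeplitz_minor sz.
pose U : 'M[{poly K}]_(size (fenum F)) := \matrix_(l, j) 'C(j, l)%:R.
rewrite -[RHS]mulr1.
have <- : \det U = 1.
  rewrite -det_tr det_trig; last first.
    by apply/is_trig_mxP => i j ij; rewrite !mxE bin_small.
  by rewrite big1 // => i _; rewrite !mxE binn.
rewrite -det_mulmx; congr (\det _); apply/matrixP => i j; rewrite !mxE cS.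
under [RHS]eq_bigr do rewrite !mxE mulr_natr.
rewrite (big_ord_widen _ (fun l => toeplitz c _ l *+ 'C(j, l)) (ltn_ord j)).
rewrite big_mkcond; apply: eq_bigr => l _.
by case: ltnP => // jl; rewrite bin_small.
Qed.

(** * The involution on finite sets *)

Lemma fenum_sorted (F : {fset nat}) : sorted ltn (fenum F).
Proof.
by rewrite ltn_sorted_uniq_leq sort_uniq fset_uniq (sort_sorted leq_total).
Qed.

Lemma fenum_lt_maxS (F : {fset nat}) : all (fun f => f < maxS F)%N (fenum F).
Proof.
apply/allP => f; rewrite mem_sort => fF.
by rewrite /maxS; apply: (@leq_bigmax_seq _ (enum_fset F) xpredT (fun f => f.+1) f).
Qed.

Lemma fenum_invol (F : {fset nat}) :
  fenum (invol F) = reflected_complement (maxS F) (fenum F).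
Proof.
have ltF f : f \in F -> (f < maxS F)%N.
  by move=> fF; apply: (allP (fenum_lt_maxS F)); rewrite mem_sort.
rewrite /reflected_complement; set N := maxS F in ltF *.
apply: (irr_sorted_eq ltn_trans); first by move=> i; rewrite /= ltnn.
- exact: fenum_sorted.
- rewrite map_rev rev_sorted; apply: (homo_sorted_in (P := fun i => (i < N)%N) (e := ltn)).
  + by move=> i j; rewrite /in_mem /= => iN jN; lia.
  + by apply/allP => i; rewrite mem_filter mem_iota => /andP[].
  + by apply: sorted_filter (iota_ltn_sorted _ _); exact: ltn_trans.
move=> i; have memN : (i \in [fset j in iota 0 N]%fset) = (i < N)%N.
  by rewrite in_fset /= -[LHS]/(i \in iota 0 N) mem_iota.
rewrite mem_sort /invol -/N in_fsetD memN.
apply/andP/mapP => [[/imfsetP nF iN] | [j]].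
  exists (N.-1 - i)%N; last by lia.
  rewrite mem_rev mem_filter mem_iota; apply/andP; split; last by lia.
  apply/negP; rewrite mem_sort => jF; apply: nF.
  by exists (N.-1 - i)%N => //=; lia.
rewrite mem_rev mem_filter mem_iota mem_sort add0n => /andP[nF /andP[_ jN]] ->.
split; last by lia.
apply/imfsetP => -[f /= fF E]; have fN := ltF f fF.
by move: nF; rewrite (_ : j = f) ?fF //; lia.
Qed.

(** The difference in w_F may be replaced by a sum, as only its parity counts. *)
Lemma sign_wF (K : numFieldType) (F : {fset nat}) :
  (-1 : K) ^ wF F = (-1) ^+ (sumn (fenum F) + 'C(size (fenum F), 2)).
Proof.
have -> : sumn (fenum F) = (\sum_(f <- F) f)%N.
  by rewrite sumnE; apply: perm_big; rewrite perm_sort.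
have -> : size (fenum F) = #|` F| by rewrite size_sort.
by rewrite /wF expfzDr ?oppr_eq0 ?oner_eq0 // -invr_expz -!exprnP -exprVn invrN1 -exprD.
Qed.

(** * The duality *)

(** Composition with -x is a ring morphism, hence commutes with determinants;
so e below may absorb the substitution. *)
Lemma casorati_invol (K : numFieldType) (a : K) (F : {fset nat}) :
  casorati a F = (-1 : K) ^ wF F *: (casorati (- a) (invol F) \Po (- 'X)).
Proof.
rewrite !casorati_toeplitz fenum_invol.
pose e i := charlier (- a) i \Po (- 'X).
rewrite (toeplitz_minor_duality (e := e) (charlier0 a) (charlier_convolution a)
           (fenum_sorted F) (fenum_lt_maxS F)).
rewrite sign_wF -mul_polyC rmorphXn rmorphN1; congr (_ * _).
rewrite /toeplitz_minor -[RHS]/(comp_poly (- 'X) _) -det_map_mx.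
congr (\det _); apply/matrixP => i j; rewrite !mxE /toeplitz.
by case: leqP => // _; rewrite rmorph0.
Qed.

Theorem theorem1p1 (R : realType) (a : R[i]) (ha : a != 0) (F : {fset nat}) :
  casorati a F = (-1 : R[i]) ^ wF F *: (casorati (- a) (invol F) \Po (- 'X)).
Proof. exact: casorati_invol. Qed.
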